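(* Let $a<b$, $m>0$, $V\in C^2(\mathbb{R})$, and let $\xi_*\in C^2([a,b])$ satisfy $$m\cosh(\dot\xi_*(t))\,\ddot\xi_*(t)+V'(\xi_*(t))=0\quad\text{on }[a,b].$$ Let $t_c$ be the first conjugate time along $\xi_*$ on $[a,b]$. If $b<t_c$ (equivalently, there is no time in $(a,b]$ conjugate to $a$ along $\xi_*$), then $\xi_*$ is a strict local minimizer of $\mathcal{L}_V$ in a sufficiently small $C^1$ neighborhood of $\xi_*$ within the class $\mathcal{V}=\{\xi_*+\eta:\eta\in C^1([a,b]),\ \eta(a)=\eta(b)=0\}$; that is, there is $\epsilon>0$ such that $\mathcal{L}_V[\xi_*+\eta]>\mathcal{L}_V[\xi_*]$ for every $\eta\in C^1([a,b])$ with $\eta(a)=\eta(b)=0$ and $0<\|\eta\|_{C^1}<\epsilon$.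
   Context: For a $C^1$ curve $\xi:[a,b]\to\mathbb{R}$, $\mathcal{L}_V[\xi]:=\int_a^b\bigl[m(\cosh(\dot\xi(t))-1)-V(\xi(t))\bigr]\,dt$. The Jacobi equation along $\xi_*$ is $\frac{d}{dt}\bigl(m\cosh(\dot\xi_*(t))\,\dot\eta(t)\bigr)+V''(\xi_*(t))\,\eta(t)=0$. A time $c\in(a,b]$ is conjugate to $a$ along $\xi_*$ if there is a nonzero $C^2$ solution $\eta$ of the Jacobi equation with $\eta(a)=0$ and $\eta(c)=0$. The first conjugate time $t_c$ on $[a,b]$ is the infimum of such $c$ in $(a,b]$, or $\infty$ if there are none. $\|\eta\|_{C^1}=\sup|\eta|+\sup|\dot\eta|$. *)

(* Defs.v *)
From Stdlib Require Import Reals Lra.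
From Coquelicot Require Import Coquelicot.
Open Scope R_scope.

Definition Icc (a b t : R) : Prop := a <= t <= b.

(* Derivative at [t] of a function on [[a,b]]: Coquelicot's [is_derive] with
   [locally t] restricted to [[a,b]], hence one-sided at the endpoints.  Values
   of [f] outside [[a,b]] play no role when [t] is in [[a,b]]. *)
Definition is_derive_on (a b : R) (f : R -> R) (t l : R) : Prop :=
  filterdiff f (within (Icc a b) (locally t)) (fun h => scal h l).

Definition ex_derive_on (a b : R) (f : R -> R) (t : R) : Prop :=
  exists l, is_derive_on a b f t l.

(* Arbitrary value where the derivative does not exist, as for [Derive]. *)
Definition Derive_on (a b : R) (f : R -> R) (t : R) : R :=
  iota (is_derive_on a b f t).

Definition C1_on (a b : R) (f : R -> R) : Prop :=
  (forall t, Icc a b t -> ex_derive_on a b f t) /\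
  continuous_on (Icc a b) (Derive_on a b f).

Definition C2_on (a b : R) (f : R -> R) : Prop :=
  C1_on a b f /\ C1_on a b (Derive_on a b f).

Definition C2_R (V : R -> R) : Prop :=
  (forall x, ex_derive_n V 1 x) /\ (forall x, ex_derive_n V 2 x) /\
  (forall x, continuous (Derive_n V 2) x).

Definition Lagr (a b m : R) (V : R -> R) (xi : R -> R) : R :=
  RInt (fun t => m * (cosh (Derive_on a b xi t) - 1) - V (xi t)) a b.

Definition euler_lagrange (a b m : R) (V xi : R -> R) : Prop :=
  forall t, Icc a b t ->
    m * cosh (Derive_on a b xi t) * Derive_on a b (Derive_on a b xi) t
    + Derive V (xi t) = 0.

Definition jacobi (a b m : R) (V xi eta : R -> R) : Prop :=
  forall t, Icc a b t ->
    Derive_on a b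
      (fun s => m * cosh (Derive_on a b xi s) * Derive_on a b eta s) t
    + Derive_n V 2 (xi t) * eta t = 0.

Definition conjugate_time (a b m : R) (V xi : R -> R) (c : R) : Prop :=
  a < c <= b /\
  exists eta : R -> R,
    C2_on a b eta /\ jacobi a b m V xi eta /\
    (exists t, Icc a b t /\ eta t <> 0) /\
    eta a = 0 /\ eta c = 0.

(* [Glb_Rbar] of the empty set is [p_infty]. *)
Definition first_conjugate_time (a b m : R) (V xi : R -> R) : Rbar :=
  Glb_Rbar (conjugate_time a b m V xi).

Definition sup_on (a b : R) (f : R -> R) : Rbar :=
  Lub_Rbar (fun y => exists t, Icc a b t /\ y = f t).

(* Extended-real valued, so that no default value is involved; it is finite
   for C^1 functions, and for [a <= b] both terms are nonnegative. *)
Definition C1_norm (a b : R) (eta : R -> R) : Rbar :=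
  Rbar_plus (sup_on a b (fun t => Rabs (eta t)))
            (sup_on a b (fun t => Rabs (Derive_on a b eta t))).

Lemma is_filter_lim_within_Icc (a b t : R) :
  is_filter_lim (within (Icc a b) (locally t)) t.
Proof.
intros P HP. apply filter_imp with (2 := HP). intros x Hx _. exact Hx.
Qed.

Lemma is_derive_on_inj (a b : R) (f : R -> R) (t l1 l2 : R) :
  a < b -> Icc a b t ->
  is_derive_on a b f t l1 -> is_derive_on a b f t l2 -> l1 = l2.
Proof.
intros Hab Ht [_ H1] [_ H2].
destruct (Req_dec l1 l2) as [e|ne]; [exact e|exfalso].
pose (d := Rabs (l1 - l2)).
assert (Hd : 0 < d) by (apply Rabs_pos_lt; lra).
assert (He : 0 < d / 3) by lra.
specialize (H1 t (is_filter_lim_within_Icc a b t) (mkposreal _ He)).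
specialize (H2 t (is_filter_lim_within_Icc a b t) (mkposreal _ He)).
destruct H1 as [e1 H1]. destruct H2 as [e2 H2].
pose (r := Rmin (Rmin e1 e2) (b - a) / 2).
assert (Hr : 0 < r /\ r < e1 /\ r < e2 /\ 2 * r <= b - a).
{ pose proof (cond_pos e1). pose proof (cond_pos e2). unfold r.
  unfold Rmin. repeat destruct Rle_dec; lra. }
destruct Hr as [Hr0 [Hr1 [Hr2 Hr3]]].
assert (Hs : exists s, Icc a b s /\ Rabs (s - t) = r).
{ unfold Icc in *. destruct (Rle_dec (t + r) b).
  - exists (t + r). split; [lra|]. replace (t + r - t) with r by ring.
    apply Rabs_pos_eq; lra.
  - exists (t - r). split; [lra|]. replace (t - r - t) with (- r) by ring.
    rewrite Rabs_Ropp. apply Rabs_pos_eq; lra. }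
destruct Hs as [s [Hs Hsr]].
assert (B1 : ball t e1 s) by (change (Rabs (s - t) < e1); lra).
assert (B2 : ball t e2 s) by (change (Rabs (s - t) < e2); lra).
specialize (H1 s B1 Hs). specialize (H2 s B2 Hs).
change (Rabs (f s - f t - (s - t) * l1) <= d / 3 * Rabs (s - t)) in H1.
change (Rabs (f s - f t - (s - t) * l2) <= d / 3 * Rabs (s - t)) in H2.
assert (H : Rabs ((s - t) * (l1 - l2)) <= 2 * (d / 3) * r).
{ replace ((s - t) * (l1 - l2)) with
    ((f s - f t - (s - t) * l2) - (f s - f t - (s - t) * l1)) by ring.
  eapply Rle_trans; [apply Rabs_triang|]. rewrite Rabs_Ropp.
  rewrite Hsr in H1, H2. lra. }
rewrite Rabs_mult, Hsr in H. fold d in H. nra.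
Qed.

Lemma is_derive_on_unique (a b : R) (f : R -> R) (t l : R) :
  a < b -> Icc a b t -> is_derive_on a b f t l -> Derive_on a b f t = l.
Proof.
intros Hab Ht H.
refine (@iota_unique R_AbsRing R_CompleteNormedModule _ l _ H).
intros y Hy. exact (is_derive_on_inj a b f t y l Hab Ht Hy H).
Qed.

(* Main.v *)
Require Import Defs.
From Stdlib Require Import Reals Lra Lia Classical.
From Coquelicot Require Import Coquelicot.
Open Scope R_scope.

(** Put [P = m cosh xi'] and [Q = V'' o xi].  Without conjugate times the Jacobi
    field [phi] with [phi a = 0], [(P phi') a = 1] is positive on [(a,b]], and
    [u = phi + s psi], where [(P psi')' + Q psi = -1] and [psi a = 1], is for small
    [s > 0] a positive solution on [[a,b]] of [(P u')' + Q u = - s].  Then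
    [w = - P u' / u] satisfies the strict Riccati inequality
    [w' = Q + s / u + w^2 / P > Q + w^2 / P], so that adding the null Lagrangian
    [(w eta^2)'] to [P eta'^2 - Q eta^2] gives a quadratic form in [(eta, eta')]
    that is pointwise at least [kappa (eta^2 + eta'^2)].  The first variation
    integrates to zero by the Euler-Lagrange equation, and for C^1-small [eta] the
    Taylor remainder of the Lagrangian is absorbed by half of the coercivity.
    Replacing functions on [[a,b]] by extensions to the line makes all derivatives
    two-sided. *)

(** * Extending functions on [[a,b]] to the line *)

Lemma is_derive_continuous (f : R -> R) (t l : R) : is_derive f t l -> continuous f t.
Proof.
intros H. apply (ex_derive_continuous (V := R_NormedModule)). now exists l.
Qed.

(* [auto_derive] leaves derivatives in this eta-expanded form. *)
Lemma Derive_eta (f : R -> R) (t l : R) : is_derive f t l -> Derive (fun s : R => f s) t = l.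
Proof.
exact (is_derive_unique f t l).
Qed.

(** For [a <= b] this is the nearest-point projection onto $[a,b]$; composing with it carries a
    function on $[a,b]$ to the line, constant on either side. *)
Definition clamp (a b t : R) : R := Rmax a (Rmin b t).

Lemma clamp_in (a b t : R) : a <= b -> Icc a b (clamp a b t).
Proof.
intros Hab. unfold Icc, clamp, Rmax, Rmin. repeat destruct Rle_dec; lra.
Qed.

Lemma clamp_id (a b t : R) : Icc a b t -> clamp a b t = t.
Proof.
unfold Icc, clamp, Rmax, Rmin. intros H. repeat destruct Rle_dec; lra.
Qed.

Lemma clamp_dist (a b s t : R) : Rabs (clamp a b s - clamp a b t) <= Rabs (s - t).
Proof.
unfold clamp, Rmax, Rmin, Rabs.
repeat destruct Rle_dec; repeat destruct Rcase_abs; lra.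
Qed.

Lemma continuous_clamp (a b : R) (f : R -> R) (t : R) :
  a <= b -> continuous_on (Icc a b) f -> continuous (fun s => f (clamp a b s)) t.
Proof.
intros Hab Hf. unfold continuous.
apply filterlim_comp with (2 := Hf (clamp a b t) (clamp_in a b t Hab)).
intros Q [d HQ]. exists d. intros s Hs. apply HQ.
- change (Rabs (clamp a b s - clamp a b t) < d).
  eapply Rle_lt_trans; [apply clamp_dist|exact Hs].
- apply clamp_in; exact Hab.
Qed.

Lemma continuous_on_all (D : R -> Prop) (f : R -> R) :
  (forall t, continuous f t) -> continuous_on D f.
Proof.
intros Hf. apply continuous_on_forall. intros t _. apply Hf.
Qed.

(** [filterdiff] quantifies over every limit point of its filter; this pins that point down to
    [t]. *)
Lemma is_filter_lim_within_eq (D : R -> Prop) (t x : R) :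
  D t -> is_filter_lim (within D (locally t)) x -> x = t.
Proof.
intros Dt Hx. apply eq_close. intros eps.
assert (H : within D (locally t) (ball x eps)) by (apply Hx, locally_ball).
exact (locally_singleton t _ H Dt).
Qed.

Lemma is_derive_is_derive_on (a b : R) (f g : R -> R) (t l : R) :
  (forall s, Icc a b s -> f s = g s) -> Icc a b t ->
  is_derive g t l -> is_derive_on a b f t l.
Proof.
intros Hfg Ht [Hl Hg]. split; [exact Hl|].
intros x Hx eps.
assert (Ex : t = x).
{ symmetry. now apply is_filter_lim_within_eq with (Icc a b). }
subst x.
assert (Ht' : is_filter_lim (locally t) t) by (intros P HP; exact HP).
destruct (Hg t Ht' eps) as [d Hd]. exists d. intros s Hs Is.
rewrite (Hfg s Is), (Hfg t Ht). exact (Hd s Hs).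
Qed.

(** Transfers ordinary calculus to $[a,b]$: by uniqueness of the one-sided derivative, [Derive_on]
    may be computed from any $C^1$ function on the line that agrees with [f] there. *)
Lemma C1_on_of_C1 (a b : R) (f g dg : R -> R) :
  a < b -> (forall s, Icc a b s -> f s = g s) ->
  (forall s, is_derive g s (dg s)) -> (forall s, continuous dg s) ->
  C1_on a b f /\ (forall s, Icc a b s -> Derive_on a b f s = dg s).
Proof.
intros Hab Hfg Hg Hdg.
assert (HD : forall s, Icc a b s -> is_derive_on a b f s (dg s)).
{ intros s Hs. apply is_derive_is_derive_on with g; auto. }
assert (HE : forall s, Icc a b s -> Derive_on a b f s = dg s).
{ intros s Hs. apply is_derive_on_unique; auto. }
split; [split|exact HE].
- intros s Hs. exists (dg s). auto.
- apply continuous_on_ext with dg.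
  + intros s Hs. symmetry. auto.
  + apply continuous_on_all, Hdg.
Qed.

Lemma Derive_on_correct (a b : R) (f : R -> R) (t : R) :
  a < b -> Icc a b t -> ex_derive_on a b f t ->
  is_derive_on a b f t (Derive_on a b f t).
Proof.
intros Hab Ht [l Hl]. rewrite (is_derive_on_unique a b f t l Hab Ht Hl). exact Hl.
Qed.

Lemma is_derive_on_eps (a b : R) (f : R -> R) (t l eps : R) :
  is_derive_on a b f t l -> 0 < eps ->
  exists d : posreal, forall s, Rabs (s - t) < d -> Icc a b s ->
    Rabs (f s - f t - (s - t) * l) <= eps * Rabs (s - t).
Proof.
intros [_ H] He.
destruct (H t (is_filter_lim_within_Icc a b t) (mkposreal _ He)) as [d Hd].
exists d. intros s Hs Is. exact (Hd s Hs Is).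
Qed.

Lemma is_derive_on_continuous_on (a b : R) (f df : R -> R) :
  (forall t, Icc a b t -> is_derive_on a b f t (df t)) -> continuous_on (Icc a b) f.
Proof.
intros H t Ht. apply filterlim_locally. intros eps.
destruct (is_derive_on_eps a b f t (df t) 1 (H t Ht) Rlt_0_1) as [d Hd].
(* The slope at [t] plus the unit error bounds the difference quotients based at [t]. *)
pose (M := Rabs (df t) + 1).
assert (HM : 0 < M) by (unfold M; pose proof (Rabs_pos (df t)); lra).
assert (Hr : 0 < Rmin d (eps / M)).
{ apply Rmin_glb_lt; [apply cond_pos|]. apply Rdiv_lt_0_compat; [apply cond_pos|lra]. }
exists (mkposreal _ Hr). intros s Hs Is.
change (Rabs (s - t) < Rmin d (eps / M)) in Hs.
assert (H1 : Rabs (s - t) < d) by (eapply Rlt_le_trans; [exact Hs|apply Rmin_l]).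
assert (H2 : Rabs (s - t) < eps / M) by (eapply Rlt_le_trans; [exact Hs|apply Rmin_r]).
specialize (Hd s H1 Is).
change (Rabs (f s - f t) < eps).
replace (f s - f t) with ((f s - f t - (s - t) * df t) + (s - t) * df t) by ring.
eapply Rle_lt_trans; [apply Rabs_triang|]. rewrite Rabs_mult.
apply Rmult_lt_compat_r with (r := M) in H2; [|lra].
replace (eps / M * M) with (pos eps) in H2 by (field; lra).
unfold M in H2. lra.
Qed.

(** A ball around an interior point with radius at most the distance to both endpoints lies in
    $[a,b]$, so the restriction of the filter is void there. *)
Lemma is_derive_on_interior (a b : R) (f g : R -> R) (t l : R) :
  (forall s, Icc a b s -> g s = f s) -> a < t < b ->
  is_derive_on a b f t l -> is_derive g t l.
Proof.
intros Hg Ht [Hl Hf]. split; [exact Hl|].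
intros x Hx eps.
assert (Ex : t = x).
{ exact (is_filter_lim_locally_unique t x Hx). }
subst x.
destruct (Hf t (is_filter_lim_within_Icc a b t) eps) as [d Hd].
assert (Hr : 0 < Rmin d (Rmin (t - a) (b - t))).
{ repeat apply Rmin_glb_lt; try lra. apply cond_pos. }
exists (mkposreal _ Hr). intros s Hs.
change (Rabs (s - t) < Rmin d (Rmin (t - a) (b - t))) in Hs.
assert (H1 : Rabs (s - t) < d) by (eapply Rlt_le_trans; [exact Hs|apply Rmin_l]).
assert (H2 : Rabs (s - t) < Rmin (t - a) (b - t))
  by (eapply Rlt_le_trans; [exact Hs|apply Rmin_r]).
assert (H3 : Rabs (s - t) < t - a) by (eapply Rlt_le_trans; [exact H2|apply Rmin_l]).
assert (H4 : Rabs (s - t) < b - t) by (eapply Rlt_le_trans; [exact H2|apply Rmin_r]).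
apply Rabs_def2 in H3. apply Rabs_def2 in H4.
assert (Is : Icc a b s) by (unfold Icc; lra).
assert (It : Icc a b t) by (unfold Icc; lra).
rewrite (Hg s Is), (Hg t It). exact (Hd s H1 Is).
Qed.

Lemma is_derive_RInt_continuous (g : R -> R) (a c t : R) :
  (forall s, continuous g s) -> is_derive (fun r => c + RInt g a r) t (g t).
Proof.
intros Hg.
assert (H : is_derive (fun r => RInt g a r) t (g t)).
{ apply is_derive_RInt with a.
  - apply filter_forall. intros r. apply RInt_correct.
    apply ex_RInt_continuous. intros z _. apply Hg.
  - apply Hg. }
rewrite <- (plus_zero_l (g t)).
exact (is_derive_plus (fun _ => c) _ t _ _ (is_derive_const c t) H).
Qed.

(** The fundamental theorem of calculus for one-sided derivatives: [f] minus the integral has zero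
    derivative in the open interval, and the mean value theorem makes it constant. *)
Lemma C1_on_integral (a b : R) (f g : R -> R) :
  a < b -> C1_on a b f -> (forall s, continuous g s) ->
  (forall s, Icc a b s -> Derive_on a b f s = g s) ->
  forall t, Icc a b t -> f t = f a + RInt g a t.
Proof.
intros Hab [Hf _] Hg HD t Ht.
pose (F := fun r => f a + RInt g a r).
assert (HF : forall r, is_derive F r (g r)).
{ intros r. apply is_derive_RInt_continuous, Hg. }
assert (Hf' : forall s, Icc a b s -> is_derive_on a b f s (g s)).
{ intros s Hs. rewrite <- (HD s Hs). apply Derive_on_correct; auto. }
(* [MVT_gen] asks for two-sided continuity at the endpoints as well, hence the [clamp]. *)
pose (k := fun r => f (clamp a b r) - F r).
destruct (MVT_gen k a t (fun _ => 0)) as [c [_ Hc]].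
- unfold Icc in Ht. rewrite Rmin_left, Rmax_right by lra. intros x Hx.
  rewrite <- (minus_eq_zero (g x) : _ = 0).
  apply (is_derive_minus (fun r => f (clamp a b r)) F); [|apply HF].
  apply (is_derive_on_interior a b f).
  + intros s Hs. now rewrite clamp_id.
  + lra.
  + apply Hf'. unfold Icc; lra.
- intros x _. apply continuity_pt_filterlim.
  apply (continuous_minus (fun r => f (clamp a b r)) F).
  + apply continuous_clamp; [lra|]. exact (is_derive_on_continuous_on a b f g Hf').
  + apply is_derive_continuous with (g x). apply HF.
- unfold k, F in Hc. rewrite RInt_point in Hc.
  rewrite (clamp_id a b t Ht), (clamp_id a b a) in Hc by (unfold Icc; lra).
  unfold zero in Hc; simpl in Hc. lra.
Qed.

(** Integrating the clamped derivative gives an extension that is affine outside $[a,b]$. *)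
Lemma C1_on_extend (a b : R) (f : R -> R) :
  a < b -> C1_on a b f ->
  exists g dg : R -> R,
    (forall t, is_derive g t (dg t)) /\ (forall t, continuous dg t) /\
    (forall t, Icc a b t -> f t = g t /\ Derive_on a b f t = dg t).
Proof.
intros Hab Hf.
pose (dg := fun s => Derive_on a b f (clamp a b s)).
assert (Hdg : forall t, continuous dg t).
{ intros t. apply continuous_clamp; [lra|]. apply Hf. }
assert (HD : forall s, Icc a b s -> Derive_on a b f s = dg s).
{ intros s Hs. unfold dg. now rewrite clamp_id. }
exists (fun t => f a + RInt dg a t), dg.
split; [|split; [exact Hdg|]].
- intros t. apply is_derive_RInt_continuous, Hdg.
- intros t Ht. split; [apply C1_on_integral with b|]; auto.
Qed.

(** The derivative is extended first; its integral then extends [f] itself. *)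
Lemma C2_on_extend (a b : R) (f : R -> R) :
  a < b -> C2_on a b f ->
  exists g dg ddg : R -> R,
    (forall t, is_derive g t (dg t)) /\ (forall t, is_derive dg t (ddg t)) /\
    (forall t, continuous ddg t) /\
    (forall t, Icc a b t -> f t = g t /\ Derive_on a b f t = dg t /\
       Derive_on a b (Derive_on a b f) t = ddg t).
Proof.
intros Hab [H1 H2].
destruct (C1_on_extend a b _ Hab H2) as [dg [ddg [Hd [Hc HE]]]].
assert (Hdg : forall t, continuous dg t).
{ intros t. now apply is_derive_continuous with (ddg t). }
exists (fun t => f a + RInt dg a t), dg, ddg.
split; [|split; [exact Hd|split; [exact Hc|]]].
- intros t. apply is_derive_RInt_continuous, Hdg.
- intros t Ht. split; [|now apply HE].
  apply C1_on_integral with b; auto. intros s Hs. now apply HE.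
Qed.

(** * Linear differential systems *)

Lemma ex_RInt_cont (f : R -> R) (a b : R) :
  (forall t, continuous f t) -> ex_RInt f a b.
Proof.
intros Hf. apply (@ex_RInt_continuous R_CompleteNormedModule). auto.
Qed.

(** A fixed point solves $u' = ku + f$, $u(a) = \alpha$. For a system, the operator is applied to
    the other component. *)
Definition volterra (a : R) (k f : R -> R) (alpha : R) (u : R -> R) (t : R) : R :=
  alpha + RInt (fun s => k s * u s + f s) a t.

Section Volterra.

Variables (a b : R) (k f : R -> R) (alpha K : R).
Hypothesis Hk : forall t, continuous k t.
Hypothesis Hf : forall t, continuous f t.
Hypothesis HK : 0 < K.
Hypothesis HkK : forall t, Icc a b t -> Rabs (k t) <= K.

Lemma continuous_integrand (u : R -> R) (t : R) :
  (forall s, continuous u s) -> continuous (fun s => k s * u s + f s) t.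
Proof.
intros Hu. apply (continuous_plus (fun s => k s * u s) f); [|apply Hf].
apply (continuous_mult k u); auto.
Qed.

Lemma is_derive_volterra (u : R -> R) (t : R) :
  (forall s, continuous u s) -> is_derive (volterra a k f alpha u) t (k t * u t + f t).
Proof.
intros Hu.
apply (is_derive_RInt_continuous (fun s => k s * u s + f s) a alpha t).
intros s. now apply continuous_integrand.
Qed.

Lemma continuous_volterra (u : R -> R) (t : R) :
  (forall s, continuous u s) -> continuous (volterra a k f alpha u) t.
Proof.
intros Hu. eapply is_derive_continuous. now apply is_derive_volterra.
Qed.

Lemma volterra_minus (u v : R -> R) (t : R) :
  (forall s, continuous u s) -> (forall s, continuous v s) ->
  volterra a k f alpha u t - volterra a k f alpha v t =
  RInt (fun s => k s * (u s - v s)) a t.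
Proof.
intros Hu Hv. unfold volterra.
assert (E : RInt (fun s => k s * (u s - v s)) a t =
  RInt (fun s => k s * u s + f s) a t - RInt (fun s => k s * v s + f s) a t).
{ rewrite <- (RInt_minus (V := R_CompleteNormedModule));
    [|apply ex_RInt_cont; intros; now apply continuous_integrand..].
  apply RInt_ext. intros s _. unfold minus, plus, opp; simpl. ring. }
rewrite E. ring.
Qed.

Lemma ex_RInt_diff (u v : R -> R) (t : R) :
  (forall s, continuous u s) -> (forall s, continuous v s) ->
  ex_RInt (fun s => k s * (u s - v s)) a t.
Proof.
intros Hu Hv. apply ex_RInt_cont. intros s.
apply (continuous_mult k (fun r => u r - v r)); [apply Hk|].
now apply (continuous_minus u v).
Qed.

(* In the weighted norm [sup exp (- 2 K (t - a)) |u t|] the integral operator is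
   a contraction of ratio 1/2. *)
Lemma volterra_contraction (u v : R -> R) (C : R) :
  (forall s, continuous u s) -> (forall s, continuous v s) -> 0 <= C ->
  (forall t, Icc a b t -> Rabs (u t - v t) <= C * exp (2 * K * (t - a))) ->
  forall t, Icc a b t ->
    Rabs (volterra a k f alpha u t - volterra a k f alpha v t)
    <= C / 2 * exp (2 * K * (t - a)).
Proof.
intros Hu Hv HC H t Ht. rewrite volterra_minus by assumption.
(* The majorant has the primitive [C / 2 * exp (2 * K * (s - a))], whence the ratio 1/2; the
   subtracted value at [a] is nonnegative and is dropped at the end. *)
assert (HI : is_RInt (fun s => K * (C * exp (2 * K * (s - a)))) a t
  (minus (C / 2 * exp (2 * K * (t - a))) (C / 2 * exp (2 * K * (a - a))))).
{ apply (is_RInt_derive (V := R_CompleteNormedModule)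
    (fun s => C / 2 * exp (2 * K * (s - a)))).
  - intros s _. auto_derive; [exact I|]. unfold Rminus. field.
  - intros s _. apply (ex_derive_continuous (V := R_NormedModule)). auto_derive. exact I. }
assert (HB : Rabs (RInt (fun s => k s * (u s - v s)) a t) <=
  minus (C / 2 * exp (2 * K * (t - a))) (C / 2 * exp (2 * K * (a - a)))).
{ unfold Icc in *.
  apply (norm_RInt_le (V := R_NormedModule) (fun s => k s * (u s - v s))
    (fun s => K * (C * exp (2 * K * (s - a)))) a t).
  - lra.
  - intros s Hs. change (Rabs (k s * (u s - v s)) <= K * (C * exp (2 * K * (s - a)))).
    rewrite Rabs_mult. apply Rmult_le_compat; try apply Rabs_pos.
    + apply HkK. lra.
    + apply H. lra.
  - apply (RInt_correct (V := R_CompleteNormedModule)). now apply ex_RInt_diff.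
  - exact HI. }
unfold minus, plus, opp in HB; simpl in HB.
pose proof (exp_pos (2 * K * (a - a))). nra.
Qed.

(** Passes to the limit on both sides of the recursion. Two sequences are kept apart because the
    components of the system feed one another. *)
Lemma volterra_fixpoint_limit (X Y : nat -> R -> R) (x y : R -> R) :
  (forall n t, continuous (Y n) t) -> (forall t, continuous y t) ->
  (forall n, X (S n) = volterra a k f alpha (Y n)) ->
  (forall d, 0 < d -> exists N, forall n t, (N <= n)%nat -> Icc a b t -> Rabs (X n t - x t) <= d) ->
  (forall d, 0 < d -> exists N, forall n t, (N <= n)%nat -> Icc a b t -> Rabs (Y n t - y t) <= d) ->
  forall t, Icc a b t -> x t = volterra a k f alpha y t.
Proof.
intros HY Hy HX Lx Ly t Ht.
apply cond_eq. intros eps Heps.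
(* With this [M] the two errors, [eps / M] and [(t - a) * (K * (eps / M))], add up to [eps / 2]. *)
pose (M := 2 * (1 + (t - a) * K)).
assert (HM : 0 < M) by (unfold M, Icc in *; nra).
assert (Hd : 0 < eps / M) by (apply Rdiv_lt_0_compat; lra).
destruct (Lx _ Hd) as [N1 H1]. destruct (Ly _ Hd) as [N2 H2].
pose (n := max N1 N2).
assert (B1 : Rabs (X (S n) t - x t) <= eps / M) by (apply H1; [lia|exact Ht]).
assert (B2 : Rabs (volterra a k f alpha (Y n) t - volterra a k f alpha y t)
  <= (t - a) * (K * (eps / M))).
{ rewrite volterra_minus by auto. apply abs_RInt_le_const.
  - apply Ht.
  - now apply ex_RInt_diff.
  - intros s Hs. assert (Is : Icc a b s) by (unfold Icc in *; lra).
    rewrite Rabs_mult. apply Rmult_le_compat; try apply Rabs_pos.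
    + auto.
    + apply H2; [lia|exact Is]. }
rewrite HX in B1.
assert (E : eps / M + (t - a) * (K * (eps / M)) = eps / 2) by (unfold M; field; unfold Icc in *; nra).
replace (x t - volterra a k f alpha y t) with
  (- (volterra a k f alpha (Y n) t - x t)
   + (volterra a k f alpha (Y n) t - volterra a k f alpha y t)) by ring.
eapply Rle_lt_trans; [apply Rabs_triang|]. rewrite Rabs_Ropp. lra.
Qed.

End Volterra.

Lemma geometric_cauchy (D : R) (v : nat -> R) :
  (forall n, Rabs (v (S n) - v n) <= D * (1 / 2) ^ n) ->
  forall n p, Rabs (v (n + p)%nat - v n) <= 2 * D * (1 / 2) ^ n.
Proof.
intros H n p.
assert (HD : 0 <= D) by (specialize (H 0%nat); pose proof (Rabs_pos (v 1%nat - v 0%nat)); simpl in H; lra).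
(* The induction needs the exact geometric partial sum; the negative tail is discarded
   afterwards. *)
assert (G : Rabs (v (n + p)%nat - v n) <= 2 * D * ((1 / 2) ^ n - (1 / 2) ^ (n + p))).
{ induction p as [|p IH].
  - rewrite Nat.add_0_r, !Rminus_diag, Rabs_R0. lra.
  - rewrite Nat.add_succ_r. specialize (H (n + p)%nat).
    replace (v (S (n + p)) - v n) with
      ((v (S (n + p)) - v (n + p)%nat) + (v (n + p)%nat - v n)) by ring.
    eapply Rle_trans; [apply Rabs_triang|]. simpl. lra. }
assert (0 < (1 / 2) ^ (n + p)) by (apply pow_lt; lra). nra.
Qed.

(** The limit comes from completeness of the functions on the line under uniform convergence;
    [clamp] turns bounds on $[a,b]$ into bounds on the whole line. *)
Lemma uniform_limit (a b D : R) (u : nat -> R -> R) :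
  a <= b -> (forall n t, continuous (u n) t) ->
  (forall n t, Icc a b t -> Rabs (u (S n) t - u n t) <= D * (1 / 2) ^ n) ->
  exists g : R -> R, (forall t, continuous g t) /\
    forall d, 0 < d -> exists N, forall n t, (N <= n)%nat -> Icc a b t ->
      Rabs (u n t - g t) <= d.
Proof.
intros Hab Hu HD.
pose (U := fun n t => u n (clamp a b t)).
assert (HU : forall n p t, Rabs (U (n + p)%nat t - U n t) <= 2 * D * (1 / 2) ^ n).
{ intros n p t. apply (geometric_cauchy D (fun n => U n t)).
  intros q. apply HD. now apply clamp_in. }
assert (Hsmall : forall d, 0 < d -> exists N, forall n, (N <= n)%nat -> 2 * D * (1 / 2) ^ n < d).
{ intros d Hd.
  assert (HL : is_lim_seq (fun n => 2 * D * (1 / 2) ^ n) 0).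
  { replace 0 with (2 * D * 0) by ring.
    apply (is_lim_seq_scal_l _ (2 * D) 0). apply is_lim_seq_geom.
    rewrite Rabs_pos_eq; lra. }
  apply is_lim_seq_spec in HL. destruct (HL (mkposreal d Hd)) as [N HN].
  exists N. intros n Hn. specialize (HN n Hn). simpl in HN.
  rewrite Rminus_0_r in HN. eapply Rle_lt_trans; [apply Rle_abs|exact HN]. }
destruct (proj1 (filterlim_locally_cauchy (U := fct_CompleteSpace (T := R) (U := R_CompleteSpace)) (F := eventually) U)) as [g Hg].
{ intros eps. destruct (Hsmall (eps / 2)) as [N HN]; [apply is_pos_div_2|].
  exists (fun n => (N <= n)%nat). split; [now exists N|].
  intros n p Hn Hp t. change (Rabs (U p t - U n t) < eps).
  assert (E1 : n = (N + (n - N))%nat) by lia.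
  assert (E2 : p = (N + (p - N))%nat) by lia.
  pose proof (HU N (n - N)%nat t) as B1. pose proof (HU N (p - N)%nat t) as B2.
  rewrite <- E1 in B1. rewrite <- E2 in B2. specialize (HN N (le_n N)).
  replace (U p t - U n t) with ((U p t - U N t) + - (U n t - U N t)) by ring.
  eapply Rle_lt_trans; [apply Rabs_triang|]. rewrite Rabs_Ropp. lra. }
assert (Hg' : forall d, 0 < d -> exists N, forall n t, (N <= n)%nat -> Rabs (U n t - g t) < d).
{ intros d Hd.
  destruct (proj1 (filterlim_locally (U := fct_UniformSpace R R_UniformSpace) U g) Hg (mkposreal d Hd)) as [N HN].
  exists N. intros n t Hn. exact (HN n Hn t). }
exists g. split.
(* A uniform limit of continuous functions is continuous, by the usual three thirds of [eps]. *)
- intros t. apply filterlim_locally. intros eps.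
  assert (He : 0 < eps / 3) by (pose proof (cond_pos eps); lra).
  destruct (Hg' _ He) as [N HN].
  assert (HC : continuous (U N) t).
  { apply (continuous_clamp a b (u N)); [exact Hab|]. apply continuous_on_all, Hu. }
  apply filterlim_locally with (eps := mkposreal _ He) in HC.
  revert HC. apply filter_imp. intros s Hs.
  change (Rabs (U N s - U N t) < eps / 3) in Hs.
  change (Rabs (g s - g t) < eps).
  pose proof (HN N s (le_n N)) as B1. pose proof (HN N t (le_n N)) as B2.
  replace (g s - g t) with (- (U N s - g s) + ((U N s - U N t) + (U N t - g t))) by ring.
  eapply Rle_lt_trans; [apply Rabs_triang|]. rewrite Rabs_Ropp.
  pose proof (Rabs_triang (U N s - U N t) (U N t - g t)). lra.
- intros d Hd. destruct (Hg' d Hd) as [N HN]. exists N. intros n t Hn Ht.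
  specialize (HN n t Hn). unfold U in HN. rewrite clamp_id in HN by exact Ht. lra.
Qed.

Lemma continuous_bounded (a b : R) (f : R -> R) :
  a <= b -> (forall t, continuous f t) ->
  exists M, 0 < M /\ forall t, Icc a b t -> Rabs (f t) <= M.
Proof.
intros Hab Hf.
destruct (continuity_ab_maj (fun t => Rabs (f t)) a b Hab) as [c [Hc _]].
{ intros t _. apply continuity_pt_filterlim.
  apply (continuous_comp f Rabs); [apply Hf|apply continuous_Rabs]. }
exists (Rabs (f c) + 1). split; [pose proof (Rabs_pos (f c)); lra|].
intros t Ht. specialize (Hc t Ht). simpl in Hc. lra.
Qed.

(** Picard iterates of $x' = ky + f$, $y' = lx + h$ from constant initial functions, both components
    being updated from the previous pair. *)
Fixpoint picard (a : R) (k l f h : R -> R) (alpha beta : R) (n : nat) : (R -> R) * (R -> R) :=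
  match n with
  | O => (fun _ => alpha, fun _ => beta)
  | S n => let xy := picard a k l f h alpha beta n in
      (volterra a k f alpha (snd xy), volterra a l h beta (fst xy))
  end.

(** With $y = Px'$ this off-diagonal form covers $(Px')' + Qx = h$. The derivatives exist on the
    whole line, but the equations are claimed only on $[a,b]$, where the convergence of the iterates
    is controlled. *)
Lemma linear_system_solution (a b : R) (k l f h : R -> R) (alpha beta : R) :
  a <= b -> (forall t, continuous k t) -> (forall t, continuous l t) ->
  (forall t, continuous f t) -> (forall t, continuous h t) ->
  exists x y dx dy : R -> R,
    x a = alpha /\ y a = beta /\
    (forall t, is_derive x t (dx t)) /\ (forall t, is_derive y t (dy t)) /\
    (forall t, continuous dx t) /\ (forall t, continuous dy t) /\
    (forall t, Icc a b t -> dx t = k t * y t + f t /\ dy t = l t * x t + h t).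
Proof.
intros Hab Hk Hl Hf Hh.
destruct (continuous_bounded a b k Hab Hk) as [K1 [HK1 B1]].
destruct (continuous_bounded a b l Hab Hl) as [K2 [HK2 B2]].
pose (K := Rmax K1 K2).
assert (HK : 0 < K) by (eapply Rlt_le_trans; [exact HK1|apply Rmax_l]).
assert (Bk : forall t, Icc a b t -> Rabs (k t) <= K).
{ intros t Ht. eapply Rle_trans; [now apply B1|apply Rmax_l]. }
assert (Bl : forall t, Icc a b t -> Rabs (l t) <= K).
{ intros t Ht. eapply Rle_trans; [now apply B2|apply Rmax_r]. }
pose (X := fun n => fst (picard a k l f h alpha beta n)).
pose (Y := fun n => snd (picard a k l f h alpha beta n)).
assert (HXY : forall n, (forall t, continuous (X n) t) /\ (forall t, continuous (Y n) t)).
{ induction n as [|n [IX IY]].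
  - split; intros t; apply continuous_const.
  - split; intros t; apply continuous_volterra; auto. }
destruct (continuous_bounded a b (fun t => X 1%nat t - X 0%nat t) Hab) as [C1 [HC1 D1]].
{ intros t. apply (continuous_minus (X 1%nat) (X 0%nat)); apply HXY. }
destruct (continuous_bounded a b (fun t => Y 1%nat t - Y 0%nat t) Hab) as [C2 [HC2 D2]].
{ intros t. apply (continuous_minus (Y 1%nat) (Y 0%nat)); apply HXY. }
pose (C := C1 + C2).
assert (HC : 0 < C) by (unfold C; lra).
(* [C] bounds the first increments, and each application of the operators halves the weighted
   bound. *)
assert (Step : forall n t, Icc a b t ->
  Rabs (X (S n) t - X n t) <= C * (1 / 2) ^ n * exp (2 * K * (t - a)) /\
  Rabs (Y (S n) t - Y n t) <= C * (1 / 2) ^ n * exp (2 * K * (t - a))).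
{ induction n as [|n IH]; intros t Ht.
  - specialize (D1 t Ht). specialize (D2 t Ht). cbv beta in D1, D2.
    assert (E : 1 <= exp (2 * K * (t - a))).
    { rewrite <- exp_0. destruct (Req_dec t a) as [->|n].
      - rewrite Rminus_diag, Rmult_0_r. lra.
      - left. apply exp_increasing. unfold Icc in Ht.
        repeat apply Rmult_lt_0_compat; lra. }
    rewrite pow_O, Rmult_1_r. unfold C in *. split; nra.
  - assert (P : 0 <= C * (1 / 2) ^ n) by (apply Rmult_le_pos; [lra|apply pow_le; lra]).
    replace (C * (1 / 2) ^ S n) with (C * (1 / 2) ^ n / 2) by (simpl; field).
    split.
    + apply (volterra_contraction a b k f alpha K) with (u := Y (S n)) (v := Y n); auto.
      1,2: apply HXY.
      intros s Hs. now apply IH.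
    + apply (volterra_contraction a b l h beta K) with (u := X (S n)) (v := X n); auto.
      1,2: apply HXY.
      intros s Hs. now apply IH. }
pose (D := C * exp (2 * K * (b - a))).
assert (HE : forall n t, Icc a b t ->
  C * (1 / 2) ^ n * exp (2 * K * (t - a)) <= D * (1 / 2) ^ n).
{ intros n t Ht. unfold D.
  assert (P : 0 < C * (1 / 2) ^ n) by (apply Rmult_lt_0_compat; [lra|apply pow_lt; lra]).
  assert (E : exp (2 * K * (t - a)) <= exp (2 * K * (b - a))).
  { destruct (Req_dec t b) as [->|n']; [lra|]. left. apply exp_increasing.
    unfold Icc in Ht. apply Rmult_lt_compat_l; lra. }
  nra. }
destruct (uniform_limit a b D X Hab (fun n => proj1 (HXY n))) as [x [Cx Lx]].
{ intros n t Ht. eapply Rle_trans; [now apply Step|now apply HE]. }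
destruct (uniform_limit a b D Y Hab (fun n => proj2 (HXY n))) as [y [Cy Ly]].
{ intros n t Ht. eapply Rle_trans; [now apply Step|now apply HE]. }
assert (Ex : forall t, Icc a b t -> x t = volterra a k f alpha y t).
{ apply (volterra_fixpoint_limit a b k f alpha K) with X Y; auto. intros n; apply HXY. }
assert (Ey : forall t, Icc a b t -> y t = volterra a l h beta x t).
{ apply (volterra_fixpoint_limit a b l h beta K) with Y X; auto. intros n; apply HXY. }
(* The images of the limits are returned instead of the limits: they are differentiable everywhere
   and coincide with [x] and [y] on $[a,b]$. *)
exists (volterra a k f alpha y), (volterra a l h beta x),
  (fun t => k t * y t + f t), (fun t => l t * x t + h t).
split; [|split; [|split; [|split; [|split; [|split]]]]].
- unfold volterra. rewrite RInt_point. apply Rplus_0_r.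
- unfold volterra. rewrite RInt_point. apply Rplus_0_r.
- intros t. now apply is_derive_volterra.
- intros t. now apply is_derive_volterra.
- intros t. now apply continuous_integrand.
- intros t. now apply continuous_integrand.
- intros t Ht. now rewrite <- Ey, <- Ex.
Qed.

(** * Positivity, Taylor remainders and quadratic forms *)

Lemma nonvanishing_pos (f : R -> R) (c d : R) :
  (forall t, continuous f t) -> (forall t, c <= t <= d -> f t <> 0) ->
  0 < f c -> forall t, c <= t <= d -> 0 < f t.
Proof.
intros Hf Hn Hc t Ht. destruct (Rlt_dec 0 (f t)) as [h|h]; [exact h|exfalso].
assert (HfC : continuity f) by (intros s; apply continuity_pt_filterlim, Hf).
destruct (IVT_gen f c t 0 HfC) as [z [Hz Ez]].
- rewrite Rmin_right, Rmax_left by lra. lra.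
- rewrite Rmin_left, Rmax_right in Hz by lra. apply (Hn z); [lra|exact Ez].
Qed.

(** With a slope error of at most [l / 2], $f(t) \ge (l/2)(t-a)$ just to the right of $a$. *)
Lemma pos_right_of_zero (f : R -> R) (a l : R) :
  is_derive f a l -> f a = 0 -> 0 < l ->
  exists d, 0 < d /\ forall t, a < t -> t < a + d -> 0 < f t.
Proof.
intros [_ H] H0 Hl.
assert (Hl2 : 0 < l / 2) by lra.
assert (La : is_filter_lim (locally a) a) by (intros P HP; exact HP).
destruct (H a La (mkposreal _ Hl2)) as [d Hd].
exists d. split; [apply cond_pos|]. intros t Ht Htd.
assert (Bt : Rabs (t - a) < d) by (rewrite Rabs_pos_eq; lra).
specialize (Hd t Bt).
change (Rabs (f t - f a - (t - a) * l) <= l / 2 * Rabs (t - a)) in Hd.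
rewrite H0, (Rabs_pos_eq (t - a)) in Hd by lra.
apply Rabs_le_between in Hd. nra.
Qed.

Lemma pos_near (f : R -> R) (a : R) :
  continuous f a -> 0 < f a -> exists d, 0 < d /\ forall t, Rabs (t - a) < d -> 0 < f t.
Proof.
intros Hf Ha.
destruct (proj1 (filterlim_locally f (f a)) Hf (mkposreal _ Ha)) as [d Hd].
exists d. split; [apply cond_pos|]. intros t Ht. specialize (Hd t Ht).
change (Rabs (f t - f a) < f a) in Hd. apply Rabs_def2 in Hd. lra.
Qed.

Lemma pos_lower_bound (f : R -> R) (c d : R) :
  c <= d -> (forall t, c <= t <= d -> continuous f t) -> (forall t, c <= t <= d -> 0 < f t) ->
  exists e, 0 < e /\ forall t, c <= t <= d -> e <= f t.
Proof.
intros Hcd Hf Hp.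
destruct (continuity_ab_min f c d Hcd) as [z [Hz Iz]].
{ intros t Ht. apply continuity_pt_filterlim. now apply Hf. }
exists (f z). auto.
Qed.

(* [phi] is positive away from [a] and [psi] is positive near [a]. *)
Lemma pos_perturbation (a b : R) (phi psi : R -> R) :
  a < b -> (forall t, continuous phi t) -> (forall t, continuous psi t) ->
  0 <= phi a -> (forall t, a < t <= b -> 0 < phi t) -> 0 < psi a ->
  exists s, 0 < s /\ forall t, Icc a b t -> 0 < phi t + s * psi t.
Proof.
intros Hab Cp Cs P0 Pp Ps.
destruct (pos_near psi a (Cs a) Ps) as [d [Hd Nd]].
(* [c] splits the interval: [psi] is positive on $[a,c]$, and [phi] has a positive minimum on
   $[c,b]$. *)
pose (c := Rmin (a + d / 2) b).
assert (Hc : a < c <= b /\ c < a + d) by (unfold c, Rmin; destruct Rle_dec; lra).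
destruct (pos_lower_bound phi c b) as [e [He Le]].
{ lra. } { auto. } { intros t Ht. apply Pp. lra. }
destruct (continuous_bounded a b psi) as [M [HM BM]]; [lra|auto|].
(* This makes $s|\psi| \le e/2 < e \le \phi$ on $[c,b]$. *)
exists (e / (2 * M)).
assert (Hs : 0 < e / (2 * M)) by (apply Rdiv_lt_0_compat; lra).
split; [exact Hs|]. intros t Ht.
destruct (Rle_dec c t) as [h|h].
- specialize (BM t Ht). apply Rabs_le_between in BM.
  assert (L : e <= phi t) by (apply Le; unfold Icc in Ht; lra).
  assert (E : e / (2 * M) * M = e / 2) by (field; lra). nra.
- assert (0 < psi t).
  { apply Nd. unfold Icc in Ht. rewrite Rabs_pos_eq; lra. }
  assert (0 <= phi t).
  { unfold Icc in Ht. destruct (Req_dec t a) as [->|n]; [exact P0|].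
    left. apply Pp. lra. }
  nra.
Qed.

(** The mean value theorem is applied twice, to the remainder of [F'] and then to that of [F];
    uniform continuity of [F''] makes [eps] independent of [x]. *)
Lemma second_order_taylor (F F' F'' : R -> R) (A B kappa : R) :
  (forall x, is_derive F x (F' x)) -> (forall x, is_derive F' x (F'' x)) ->
  (forall x, continuous F'' x) -> 0 < kappa ->
  exists eps, 0 < eps /\ forall x h, A <= x <= B -> Rabs h < eps ->
    Rabs (F (x + h) - F x - F' x * h - F'' x * h ^ 2 / 2) <= kappa * h ^ 2.
Proof.
intros H1 H2 Hc Hk.
(* The interval is enlarged by 1 on each side to contain the intermediate points, which is why [eps]
   is capped by 1. *)
destruct (Heine_cor2 (f := F'') (a := A - 1) (b := B + 1)
  (fun x _ => proj2 (continuity_pt_filterlim F'' x) (Hc x)) (mkposreal _ Hk)) as [d Hd].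
simpl in Hd.
exists (Rmin d 1). split; [apply Rmin_glb_lt; [apply cond_pos|lra]|].
intros x h Hx Hh.
assert (h1 : Rabs h < d) by (eapply Rlt_le_trans; [exact Hh|apply Rmin_l]).
assert (h2 : Rabs h < 1) by (eapply Rlt_le_trans; [exact Hh|apply Rmin_r]).
assert (Hbt : forall r c, Rmin 0 r <= c <= Rmax 0 r -> Rabs c <= Rabs r).
{ intros r c. unfold Rmin, Rmax, Rabs.
  repeat destruct Rle_dec; repeat destruct Rcase_abs; lra. }
assert (G1 : forall r, Rabs r <= Rabs h ->
  Rabs (F' (x + r) - F' x - F'' x * r) <= kappa * Rabs r).
{ intros r Hr.
  assert (HG : forall y, is_derive (fun r => F' (x + r) - F'' x * r) y (F'' (x + y) - F'' x)).
  { intros y. auto_derive; [now exists (F'' (x + y))|].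
    rewrite (Derive_eta _ _ _ (H2 (x + y))). ring. }
  destruct (MVT_gen (fun r => F' (x + r) - F'' x * r) 0 r (fun r => F'' (x + r) - F'' x))
    as [c [Ic Ec]].
  - intros y _. apply HG.
  - intros y _. apply continuity_pt_filterlim.
    exact (is_derive_continuous _ _ _ (HG y)).
  - apply Hbt in Ic.
    replace (F' (x + r) - F' x - F'' x * r) with
      ((F' (x + r) - F'' x * r) - (F' (x + 0) - F'' x * 0)) by (rewrite Rplus_0_r; ring).
    rewrite Ec, Rminus_0_r, Rabs_mult. apply Rmult_le_compat_r; [apply Rabs_pos|].
    left. apply Hd.
    + assert (Rabs c < 1) by lra. apply Rabs_def2 in H. lra.
    + lra.
    + replace (x + c - x) with c by ring. lra. }
assert (HG : forall y, is_derive (fun r => F (x + r) - F' x * r - F'' x * r ^ 2 / 2) y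
  (F' (x + y) - F' x - F'' x * y)).
{ intros y. auto_derive; [now exists (F' (x + y))|].
  rewrite (Derive_eta _ _ _ (H1 (x + y))). field. }
destruct (MVT_gen (fun r => F (x + r) - F' x * r - F'' x * r ^ 2 / 2) 0 h
  (fun r => F' (x + r) - F' x - F'' x * r)) as [c [Ic Ec]].
- intros y _. apply HG.
- intros y _. apply continuity_pt_filterlim.
  exact (is_derive_continuous _ _ _ (HG y)).
- apply Hbt in Ic.
  replace (F (x + h) - F x - F' x * h - F'' x * h ^ 2 / 2) with
    ((F (x + h) - F' x * h - F'' x * h ^ 2 / 2) - (F (x + 0) - F' x * 0 - F'' x * 0 ^ 2 / 2))
    by (rewrite Rplus_0_r; field).
  rewrite Ec, Rminus_0_r, Rabs_mult.
  apply Rle_trans with (kappa * Rabs c * Rabs h).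
  + apply Rmult_le_compat_r; [apply Rabs_pos|]. now apply G1.
  + rewrite <- (pow2_abs h). pose proof (Rabs_pos h). pose proof (Rabs_pos c).
    replace (kappa * Rabs h ^ 2) with (kappa * Rabs h * Rabs h) by ring.
    apply Rmult_le_compat_r; [lra|]. apply Rmult_le_compat_l; lra.
Qed.

(* The quadratic form is [P (y + w x / P)^2 + s x^2] with [P >= m] and [|w| <= W]. *)
Lemma riccati_form_coercive (m W sg : R) :
  0 < m -> 0 <= W -> 0 < sg ->
  exists kappa, 0 < kappa /\ forall P w s x y,
    m <= P -> Rabs w <= W -> sg <= s ->
    kappa * (x ^ 2 + y ^ 2) <= P * y ^ 2 + 2 * w * x * y + (s + w ^ 2 / P) * x ^ 2.
Proof.
intros Hm HW Hs.
(* [v] bounds $|q|$ for $q = w/P$. With $z = y + qx$ one has $x^2 + y^2 \le 2z^2 + Dx^2$, and the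
   two entries of the minimum give $2\kappa \le m$ and [kappa * D <= sg]. *)
pose (v := W / m).
assert (Hv : 0 <= v) by (unfold v; apply Rle_div_r; lra).
pose (D := 2 * v ^ 2 + 1).
assert (HD : 1 <= D) by (unfold D; nra).
exists (Rmin (m / 2) (sg / D)).
assert (K0 : 0 < Rmin (m / 2) (sg / D)).
{ apply Rmin_glb_lt; [lra|apply Rdiv_lt_0_compat; lra]. }
split; [exact K0|]. intros P w s x y HP Hw Hsg.
assert (K1 := Rmin_l (m / 2) (sg / D)). assert (K2 := Rmin_r (m / 2) (sg / D)).
set (kappa := Rmin (m / 2) (sg / D)) in *.
assert (K3 : kappa * D <= sg).
{ apply Rmult_le_compat_r with (r := D) in K2; [|lra].
  replace (sg / D * D) with sg in K2 by (field; lra). exact K2. }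
pose (q := w / P).
assert (Hq : q ^ 2 <= v ^ 2).
{ rewrite <- (pow2_abs q). apply pow_incr. split; [apply Rabs_pos|].
  unfold q, v, Rdiv. rewrite Rabs_mult, Rabs_inv, (Rabs_pos_eq P) by lra.
  apply Rmult_le_compat; [apply Rabs_pos| |exact Hw|].
  - left. apply Rinv_0_lt_compat. lra.
  - apply Rinv_le_contravar; lra. }
replace (P * y ^ 2 + 2 * w * x * y + (s + w ^ 2 / P) * x ^ 2) with
  (P * (y + q * x) ^ 2 + s * x ^ 2) by (unfold q; field; lra).
pose (z := y + q * x).
assert (Hy : y ^ 2 <= 2 * z ^ 2 + 2 * q ^ 2 * x ^ 2).
{ replace y with (z - q * x) by (unfold z; ring).
  assert (0 <= (z + q * x) ^ 2) by apply pow2_ge_0. nra. }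
fold z.
assert (Z : 0 <= z ^ 2) by apply pow2_ge_0.
assert (X : 0 <= x ^ 2) by apply pow2_ge_0.
assert (A1 : 2 * kappa * z ^ 2 <= P * z ^ 2) by (apply Rmult_le_compat_r; lra).
assert (A2 : kappa * D * x ^ 2 <= s * x ^ 2) by (apply Rmult_le_compat_r; lra).
assert (A3 : q ^ 2 * x ^ 2 <= v ^ 2 * x ^ 2) by (apply Rmult_le_compat_r; lra).
assert (A4 : kappa * (x ^ 2 + y ^ 2) <= kappa * (x ^ 2 + (2 * z ^ 2 + 2 * (v ^ 2 * x ^ 2)))).
{ apply Rmult_le_compat_l; lra. }
unfold D in A2. lra.
Qed.

(** $E^2$ has derivative $2EE' \le E^2 + E'^2$. This makes the coercive integral strictly positive
    for a nonzero variation. *)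
Lemma sqr_le_RInt_sqr (a b : R) (E dE : R -> R) (t : R) :
  (forall s, is_derive E s (dE s)) -> (forall s, continuous dE s) -> E a = 0 ->
  Icc a b t -> E t ^ 2 <= RInt (fun s => E s ^ 2 + dE s ^ 2) a b.
Proof.
intros HE Hc E0 Ht.
assert (CE : forall s, continuous E s) by (intros s; now apply is_derive_continuous with (dE s)).
assert (Csq : forall (f : R -> R) s, (forall r, continuous f r) -> continuous (fun r => f r ^ 2) s).
{ intros f s Hf. apply (continuous_mult f (fun r => f r * 1)); [apply Hf|].
  apply (continuous_mult f (fun _ => 1)); [apply Hf|apply continuous_const]. }
assert (CI : forall s, continuous (fun s => E s ^ 2 + dE s ^ 2) s).
{ intros s. apply (continuous_plus (fun s => E s ^ 2) (fun s => dE s ^ 2)); auto. }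
assert (H1 : is_RInt (fun s => 2 * E s * dE s) a t (minus (E t ^ 2) (E a ^ 2))).
{ apply (is_RInt_derive (V := R_CompleteNormedModule) (fun s => E s ^ 2)).
  - intros s _. auto_derive; [now exists (dE s)|].
    rewrite (Derive_eta _ _ _ (HE s)). ring.
  - intros s _. apply (continuous_mult (fun s => 2 * E s) dE); [|apply Hc].
    apply (continuous_mult (fun _ => 2) E); [apply continuous_const|apply CE]. }
assert (H2 : E t ^ 2 <= RInt (fun s => E s ^ 2 + dE s ^ 2) a t).
{ replace (E t ^ 2) with (minus (E t ^ 2) (E a ^ 2))
    by (rewrite E0; unfold minus, plus, opp; simpl; ring).
  apply (is_RInt_le _ (fun s => E s ^ 2 + dE s ^ 2) a t _ _ (proj1 Ht) H1).
  - apply (RInt_correct (V := R_CompleteNormedModule)). now apply ex_RInt_cont.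
  - intros s _. pose proof (pow2_ge_0 (E s - dE s)). nra. }
assert (H3 : 0 <= RInt (fun s => E s ^ 2 + dE s ^ 2) t b).
{ apply RInt_ge_0; [apply Ht|now apply ex_RInt_cont|].
  intros s _. pose proof (pow2_ge_0 (E s)). pose proof (pow2_ge_0 (dE s)). lra. }
pose proof (RInt_Chasles (V := R_CompleteNormedModule) (fun s => E s ^ 2 + dE s ^ 2) a t b
  (ex_RInt_cont _ _ _ CI) (ex_RInt_cont _ _ _ CI)) as H4.
unfold plus in H4; simpl in H4. simpl in *. lra.
Qed.

(** * The second variation *)

(* Here [phi] is the Jacobi field with [phi a = 0], positive on [(a,b]]; adding a small
   multiple of the solution of the equation with right-hand side [-1] and value 1
   at [a] makes it positive up to [a]. *)
Lemma positive_supersolution (a b : R) (P Q : R -> R) :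
  a < b -> (forall t, continuous P t) -> (forall t, continuous Q t) ->
  (forall t, 0 < P t) ->
  (forall x y dx dy : R -> R,
     (forall t, is_derive x t (dx t)) -> (forall t, is_derive y t (dy t)) ->
     (forall t, continuous dx t) -> (forall t, continuous dy t) ->
     (forall t, Icc a b t -> dx t = y t / P t /\ dy t = - Q t * x t) ->
     x a = 0 -> y a = 1 -> forall c, a < c <= b -> x c <> 0) ->
  exists (s : R) (u p du dp : R -> R), 0 < s /\
    (forall t, is_derive u t (du t)) /\ (forall t, is_derive p t (dp t)) /\
    (forall t, Icc a b t ->
       du t = p t / P t /\ dp t = - Q t * u t - s /\ 0 < u t).
Proof.
intros Hab CP CQ HP Hnc.
assert (Ck : forall t, continuous (fun t => / P t) t).
{ intros t. apply continuous_comp with (g := Rinv); [apply CP|].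
  apply continuous_Rinv. apply Rgt_not_eq, HP. }
assert (Cl : forall t, continuous (fun t => - Q t) t).
{ intros t. apply (continuous_opp Q), CQ. }
assert (Cc : forall c t : R, continuous (fun _ : R => c) t) by (intros; apply continuous_const).
destruct (linear_system_solution a b (fun t => / P t) (fun t => - Q t) (fun _ => 0) (fun _ => 0)
  0 1 (Rlt_le _ _ Hab) Ck Cl (Cc 0) (Cc 0))
  as (x & y & dx & dy & xa & ya & Hx & Hy & Cx & Cy & E).
(* The second solution [x1] has right-hand side -1, value 1 at [a] and zero initial momentum. *)
destruct (linear_system_solution a b (fun t => / P t) (fun t => - Q t) (fun _ => 0) (fun _ => -1)
  1 0 (Rlt_le _ _ Hab) Ck Cl (Cc 0) (Cc (-1)))
  as (x1 & y1 & dx1 & dy1 & xa1 & ya1 & Hx1 & Hy1 & Cx1 & Cy1 & E1).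
assert (Nx : forall c, a < c <= b -> x c <> 0).
{ apply (Hnc x y dx dy); auto. intros t Ht. destruct (E t Ht) as [-> ->]. split.
  - field. apply Rgt_not_eq, HP.
  - ring. }
assert (Conx : forall t, continuous x t) by (intros t; now apply is_derive_continuous with (dx t)).
assert (Conx1 : forall t, continuous x1 t) by (intros t; now apply is_derive_continuous with (dx1 t)).
(* [x] leaves 0 with slope [/ P a > 0], and without a zero in $(a,b]$ it cannot change sign. *)
assert (Px : forall t, a < t <= b -> 0 < x t).
{ destruct (pos_right_of_zero x a (dx a)) as [d [Hd Pd]]; [apply Hx|exact xa| |].
  - assert (Ia : Icc a b a) by (unfold Icc; lra).
    destruct (E a Ia) as [-> _]. rewrite ya.
    pose proof (Rinv_0_lt_compat _ (HP a)). lra.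
  - intros t Ht. pose (c := Rmin (a + d / 2) t).
    assert (Hc : a < c <= t /\ c < a + d) by (unfold c, Rmin; destruct Rle_dec; lra).
    apply (nonvanishing_pos x c t); try lra; auto.
    + intros r Hr. apply Nx. lra.
    + apply Pd; lra. }
destruct (pos_perturbation a b x x1) as [s [Hs Pu]]; auto; try lra.
exists s, (fun t => x t + s * x1 t), (fun t => y t + s * y1 t),
  (fun t => dx t + s * dx1 t), (fun t => dy t + s * dy1 t).
split; [exact Hs|]. split; [|split].
- intros t. apply (is_derive_plus x (fun t => s * x1 t)); [apply Hx|].
  apply is_derive_scal, Hx1.
- intros t. apply (is_derive_plus y (fun t => s * y1 t)); [apply Hy|].
  apply is_derive_scal, Hy1.
- intros t Ht. destruct (E t Ht) as [-> ->]. destruct (E1 t Ht) as [-> ->].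
  split; [|split; [ring|now apply Pu]]. field. apply Rgt_not_eq, HP.
Qed.

(** The mean value theorem for $\int F - G$ asks for no integrability of [dG] and for
    differentiability of [G] only on $[a,b]$; this suits [w], which is controlled only where [u] is
    known to be positive. *)
Lemma increment_le_RInt (a b : R) (G dG F : R -> R) :
  a <= b -> (forall t, continuous F t) ->
  (forall t, Icc a b t -> is_derive G t (dG t)) ->
  (forall t, Icc a b t -> dG t <= F t) -> G b - G a <= RInt F a b.
Proof.
intros Hab CF HG HL.
assert (HD : forall t, Icc a b t ->
  is_derive (fun t => RInt F a t - G t) t (F t - dG t)).
{ intros t Ht. apply (is_derive_minus (fun t => RInt F a t) G); [|now apply HG].
  apply is_derive_RInt with a; [|apply CF].
  apply filter_forall. intros r. apply (RInt_correct (V := R_CompleteNormedModule)).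
  now apply ex_RInt_cont. }
destruct (MVT_gen (fun t => RInt F a t - G t) a b (fun t => F t - dG t)) as [c [Ic Ec]].
- rewrite Rmin_left, Rmax_right by lra. intros t Ht. apply HD. unfold Icc; lra.
- rewrite Rmin_left, Rmax_right by lra. intros t Ht. apply continuity_pt_filterlim.
  exact (is_derive_continuous _ _ _ (HD t Ht)).
- rewrite Rmin_left, Rmax_right in Ic by lra.
  rewrite RInt_point in Ec. unfold zero in Ec; simpl in Ec.
  specialize (HL c Ic). nra.
Qed.

(** * Sup norms and the first conjugate time *)

Lemma sup_on_ub (a b : R) (f : R -> R) (t : R) : Icc a b t -> Rbar_le (f t) (sup_on a b f).
Proof.
intros Ht. apply (proj1 (Lub_Rbar_correct _)). now exists t.
Qed.

Lemma sup_on_zero (a b : R) (f : R -> R) :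
  a <= b -> (forall t, Icc a b t -> f t = 0) -> sup_on a b f = 0.
Proof.
intros Hab Hf. apply is_lub_Rbar_unique. split.
- intros y [t [Ht ->]]. rewrite Hf by exact Ht. apply Rle_refl.
- intros l Hl. apply (Hl 0). exists a. split; [unfold Icc; lra|].
  symmetry. apply Hf. unfold Icc; lra.
Qed.

(** Both suprema dominate a nonnegative value, so neither is [m_infty]; the finite bound on their
    sum then excludes [p_infty] and bounds each of them. *)
Lemma C1_norm_lt (a b eps : R) (eta : R -> R) :
  Rbar_lt (C1_norm a b eta) eps ->
  forall t, Icc a b t -> Rabs (eta t) < eps /\ Rabs (Derive_on a b eta t) < eps.
Proof.
unfold C1_norm. intros H t Ht.
pose proof (sup_on_ub a b (fun t => Rabs (eta t)) t Ht) as H1.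
pose proof (sup_on_ub a b (fun t => Rabs (Derive_on a b eta t)) t Ht) as H2.
pose proof (Rabs_pos (eta t)). pose proof (Rabs_pos (Derive_on a b eta t)).
cbv beta in H1, H2.
destruct (sup_on a b (fun t => Rabs (eta t))) as [x| |];
destruct (sup_on a b (fun t => Rabs (Derive_on a b eta t))) as [y| |];
simpl in *; try contradiction. lra.
Qed.

(** If [eta] vanished on $[a,b]$, so would its [Derive_on], and the norm would be 0. *)
Lemma C1_norm_pos (a b : R) (eta : R -> R) :
  a < b -> Rbar_lt 0 (C1_norm a b eta) -> exists t, Icc a b t /\ eta t <> 0.
Proof.
intros Hab H. apply NNPP. intros Hn.
assert (Z : forall t, Icc a b t -> eta t = 0).
{ intros t Ht. apply NNPP. intros Hz. apply Hn. now exists t. }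
destruct (C1_on_of_C1 a b eta (fun _ => 0) (fun _ => 0) Hab Z) as [_ DZ].
{ intros s. apply (is_derive_const 0). }
{ intros s. apply continuous_const. }
unfold C1_norm in H. rewrite !sup_on_zero in H.
- simpl in H. lra.
- lra.
- intros t Ht. now rewrite DZ, Rabs_R0.
- lra.
- intros t Ht. now rewrite Z, Rabs_R0.
Qed.

(** A conjugate time is at most [b] and pulls the infimum down to [b] or below; the infimum of the
    empty set is [p_infty]. *)
Lemma lt_first_conjugate_time (a b m : R) (V xi : R -> R) :
  Rbar_lt b (first_conjugate_time a b m V xi) <->
  ~ (exists c : R, conjugate_time a b m V xi c).
Proof.
unfold first_conjugate_time. split.
- intros H [c Hc].
  pose proof (proj1 (Glb_Rbar_correct (conjugate_time a b m V xi)) c Hc) as Hle.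
  pose proof (Rbar_lt_le_trans _ _ _ H Hle) as Hlt.
  destruct Hc as [Hc _]. simpl in Hlt. lra.
- intros H.
  rewrite (is_glb_Rbar_unique (conjugate_time a b m V xi) p_infty); [exact I|]. split.
  + intros c Hc. exfalso. apply H. now exists c.
  + intros l _. destruct l; exact I.
Qed.

(** * Hyperbolic functions *)

Lemma is_derive_cosh (t : R) : is_derive cosh t (sinh t).
Proof.
apply is_derive_Reals, derivable_pt_lim_cosh.
Qed.

Lemma is_derive_sinh (t : R) : is_derive sinh t (cosh t).
Proof.
apply is_derive_Reals, derivable_pt_lim_sinh.
Qed.

Lemma cosh_ge_1 (t : R) : 1 <= cosh t.
Proof.
unfold cosh. rewrite exp_Ropp.
pose proof (exp_pos t) as He. set (e := exp t) in *.
assert (H : (e + / e) / 2 - 1 = (e - 1) ^ 2 / (2 * e)) by (field; lra).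
assert (0 <= (e - 1) ^ 2 / (2 * e)).
{ apply Rdiv_le_0_compat; [apply pow2_ge_0|lra]. }
lra.
Qed.

(* Extensions to [R] of [xi] and its derivatives are [X], [h], [dh]. *)
Section Minimality.

Variables (a b m : R) (V V1 V2 X h dh : R -> R).
Hypothesis Hab : a < b.
Hypothesis Hm : 0 < m.
Hypothesis HV1 : forall x, is_derive V x (V1 x).
Hypothesis HV2 : forall x, is_derive V1 x (V2 x).
Hypothesis CV2 : forall x, continuous V2 x.
Hypothesis HX : forall t, is_derive X t (h t).
Hypothesis Hh : forall t, is_derive h t (dh t).
Hypothesis HEL : forall t, Icc a b t -> m * cosh (h t) * dh t + V1 (X t) = 0.

Let P (t : R) : R := m * cosh (h t).
Let Q (t : R) : R := V2 (X t).

(** The positive supersolution [u] with momentum [p], in the form delivered by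
    [positive_supersolution]. *)
Variables (s : R) (u p du dp : R -> R).
Hypothesis Hs : 0 < s.
Hypothesis Hu : forall t, is_derive u t (du t).
Hypothesis Hp : forall t, is_derive p t (dp t).
Hypothesis Hup : forall t, Icc a b t ->
  du t = p t / P t /\ dp t = - Q t * u t - s /\ 0 < u t.

Let w (t : R) : R := - (p t / u t).

Lemma P_ge (t : R) : m <= P t.
Proof.
unfold P. pose proof (cosh_ge_1 (h t)). nra.
Qed.

(** On $[a,b]$, $-(p'u - pu')/u^2 = (Qu + s)/u + p^2/(Pu^2)$, and the last term is $w^2/P$. *)
Lemma riccati (t : R) : Icc a b t -> is_derive w t (Q t + s / u t + w t ^ 2 / P t).
Proof.
intros Ht. destruct (Hup t Ht) as [E1 [E2 Pu]]. pose proof (P_ge t).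
replace (Q t + s / u t + w t ^ 2 / P t) with (- ((dp t * u t - p t * du t) / u t ^ 2)).
- apply (is_derive_opp (fun t => p t / u t)). apply is_derive_div; auto. lra.
- rewrite E1, E2. unfold w. field. lra.
Qed.

(** By compactness $e \le u \le M_u$ and $|p| \le M_p$ on $[a,b]$, so $|w| \le M_p/e$ and $s/u \ge
    s/M_u$; hence [kappa] does not depend on [t]. *)
Lemma accessory_form_coercive : exists kappa, 0 < kappa /\ forall t x y, Icc a b t ->
  kappa * (x ^ 2 + y ^ 2) <= P t * y ^ 2 + 2 * w t * x * y + (s / u t + w t ^ 2 / P t) * x ^ 2.
Proof.
assert (Cu : forall t, continuous u t) by (intros t; now apply is_derive_continuous with (du t)).
assert (Cp : forall t, continuous p t) by (intros t; now apply is_derive_continuous with (dp t)).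
destruct (pos_lower_bound u a b) as [e [He Le]]; [lra|auto|intros t Ht; now apply Hup|].
destruct (continuous_bounded a b u) as [Mu [HMu BMu]]; [lra|exact Cu|].
destruct (continuous_bounded a b p) as [Mp [HMp BMp]]; [lra|exact Cp|].
destruct (riccati_form_coercive m (Mp / e) (s / Mu)) as [kappa [Hk K]].
- exact Hm.
- apply Rdiv_le_0_compat; lra.
- apply Rdiv_lt_0_compat; lra.
- exists kappa. split; [exact Hk|]. intros t x y Ht. apply K.
  + apply P_ge.
  + specialize (Le t Ht). unfold w, Rdiv. rewrite Rabs_Ropp, Rabs_mult, Rabs_inv.
    rewrite (Rabs_pos_eq (u t)) by lra.
    apply Rmult_le_compat; [apply Rabs_pos| |now apply BMp|].
    * left. apply Rinv_0_lt_compat. lra.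
    * apply Rinv_le_contravar; lra.
  + specialize (Le t Ht). specialize (BMu t Ht). apply Rabs_le_between in BMu.
    apply Rmult_le_compat_l; [lra|]. apply Rinv_le_contravar; lra.
Qed.

(** The factor 1/2 of the second-order Taylor term leaves [kappa / 2] of the coercivity; the
    remainders consume [kappa / 4], and the other [kappa / 4] yields the strict increase. *)
Lemma action_increment_pos : exists eps, 0 < eps /\ forall E dE : R -> R,
  (forall t, is_derive E t (dE t)) -> (forall t, continuous dE t) ->
  E a = 0 -> E b = 0 -> (exists t, Icc a b t /\ E t <> 0) ->
  (forall t, Icc a b t -> Rabs (E t) < eps /\ Rabs (dE t) < eps) ->
  RInt (fun t => m * (cosh (h t) - 1) - V (X t)) a b <
  RInt (fun t => m * (cosh (h t + dE t) - 1) - V (X t + E t)) a b.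
Proof.
assert (CX : forall t, continuous X t) by (intros t; now apply is_derive_continuous with (h t)).
assert (Ch : forall t, continuous h t) by (intros t; now apply is_derive_continuous with (dh t)).
destruct accessory_form_coercive as [kappa [Hk K]].
destruct (continuous_bounded a b h) as [Mh [_ Bh]]; [lra|exact Ch|].
destruct (continuous_bounded a b X) as [MX [_ BX]]; [lra|exact CX|].
(* The Lagrangian multiplies this remainder by [m], so its cost is [kappa / 4 * dE t ^ 2]. *)
destruct (second_order_taylor cosh sinh cosh (- Mh) Mh (kappa / (4 * m)))
  as [e1 [He1 T1]].
{ apply is_derive_cosh. } { apply is_derive_sinh. }
{ intros x. exact (is_derive_continuous _ _ _ (is_derive_cosh x)). }
{ apply Rdiv_lt_0_compat; lra. }
destruct (second_order_taylor V V1 V2 (- MX) MX (kappa / 4)) as [e2 [He2 T2]];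
  [assumption..|lra|].
exists (Rmin e1 e2). split; [now apply Rmin_glb_lt|].
intros E dE HE CdE Ea Eb [t0 [It0 Et0]] Hsmall.
assert (CE : forall t, continuous E t) by (intros t; now apply is_derive_continuous with (dE t)).
assert (CL : forall f g : R -> R, (forall t, continuous f t) -> (forall t, continuous g t) ->
  forall t, continuous (fun t => m * (cosh (f t) - 1) - V (g t)) t).
{ intros f g Cf Cg t.
  apply (continuous_minus (fun t => m * (cosh (f t) - 1)) (fun t => V (g t))).
  - apply (continuous_mult (fun _ => m) (fun t => cosh (f t) - 1)); [apply continuous_const|].
    apply (continuous_minus (fun t => cosh (f t)) (fun _ => 1)); [|apply continuous_const].
    apply (continuous_comp f cosh); [apply Cf|].
    exact (is_derive_continuous _ _ _ (is_derive_cosh (f t))).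
  - apply (continuous_comp g V); [apply Cg|].
    exact (is_derive_continuous _ _ _ (HV1 (g t))). }
pose (L0 := fun t => m * (cosh (h t) - 1) - V (X t)).
pose (L1 := fun t => m * (cosh (h t + dE t) - 1) - V (X t + E t)).
pose (N := fun t => E t ^ 2 + dE t ^ 2).
assert (C0 : forall t, continuous L0 t) by (apply CL; assumption).
assert (C1 : forall t, continuous L1 t).
{ apply (CL (fun t => h t + dE t) (fun t => X t + E t)).
  - intros t. now apply (continuous_plus h dE).
  - intros t. now apply (continuous_plus X E). }
assert (Csq : forall f : R -> R, (forall t, continuous f t) -> forall t, continuous (fun t => f t ^ 2) t).
{ intros f Cf t. apply (continuous_mult f (fun t => f t * 1)); [apply Cf|].
  apply (continuous_mult f (fun _ => 1)); [apply Cf|apply continuous_const]. }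
assert (CN : forall t, continuous N t).
{ intros t. apply (continuous_plus (fun t => E t ^ 2) (fun t => dE t ^ 2)); auto. }
assert (CkN : forall t, continuous (fun t => kappa / 4 * N t) t).
{ intros t. apply (continuous_mult (fun _ => kappa / 4) N); [apply continuous_const|apply CN]. }
assert (C10 : forall t, continuous (fun t => L1 t - L0 t) t).
{ intros t. now apply (continuous_minus L1 L0). }
(* [G] collects the boundary term of the first variation and half of the null Lagrangian's primitive
   $w E^2$; both vanish with [E] at the endpoints. *)
pose (G := fun t => m * sinh (h t) * E t - w t * E t ^ 2 / 2).
pose (dG := fun t => P t * dh t * E t + m * sinh (h t) * dE t
  - ((Q t + s / u t + w t ^ 2 / P t) * E t ^ 2 / 2 + w t * E t * dE t)).
assert (HG : forall t, Icc a b t -> is_derive G t (dG t)).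
{ intros t Ht. pose proof (riccati t Ht) as Hw. unfold G.
  auto_derive.
  - repeat split; [exists (dh t); apply Hh|now exists (dE t)|eexists; exact Hw|now exists (dE t)].
  - rewrite (Derive_eta _ _ _ (Hh t)), (Derive_eta _ _ _ (HE t)), (Derive_eta _ _ _ Hw).
    unfold dG. change (P t) with (m * cosh (h t)). field.
    pose proof (cosh_ge_1 (h t)). destruct (Hup t Ht) as [_ [_ Pu]].
    repeat split; lra. }
assert (HL : forall t, Icc a b t -> dG t <= L1 t - L0 t - kappa / 4 * N t).
{ intros t Ht. destruct (Hsmall t Ht) as [S1 S2].
  assert (t1 := T1 (h t) (dE t) (proj1 (Rabs_le_between _ _) (Bh t Ht))
    (Rlt_le_trans _ _ _ S2 (Rmin_l _ _))).
  assert (t2 := T2 (X t) (E t) (proj1 (Rabs_le_between _ _) (BX t Ht))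
    (Rlt_le_trans _ _ _ S1 (Rmin_r _ _))).
  apply Rabs_le_between in t1. apply Rabs_le_between in t2.
  destruct t1 as [t1 _]. destruct t2 as [_ t2].
  apply Rmult_le_compat_l with (r := m) in t1; [|lra].
  replace (m * - (kappa / (4 * m) * dE t ^ 2)) with (- (kappa / 4 * dE t ^ 2)) in t1
    by (field; lra).
  pose proof (K t (E t) (dE t) Ht) as k1.
  (* The Euler-Lagrange equation matches the derivative of $m \sinh h$ with the first-order term of
     the potential. *)
  assert (el : P t * dh t * E t = - V1 (X t) * E t).
  { specialize (HEL t Ht). unfold P. replace (m * cosh (h t) * dh t) with (- V1 (X t)) by lra.
    reflexivity. }
  unfold dG, L1, L0, N. rewrite el. unfold P, Q in *. lra. }
assert (HI : G b - G a <= RInt (fun t => L1 t - L0 t - kappa / 4 * N t) a b).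
{ apply increment_le_RInt with dG; [lra| |exact HG|exact HL].
  intros t. now apply (continuous_minus (fun t => L1 t - L0 t) (fun t => kappa / 4 * N t)). }
assert (EG : G b - G a = 0) by (unfold G; rewrite Ea, Eb; field).
assert (EI : RInt (fun t => L1 t - L0 t - kappa / 4 * N t) a b =
  RInt L1 a b - RInt L0 a b - kappa / 4 * RInt N a b).
{ apply is_RInt_unique.
  apply (is_RInt_minus (V := R_NormedModule) (fun t => L1 t - L0 t) (fun t => kappa / 4 * N t)).
  - apply (is_RInt_minus (V := R_NormedModule) L1 L0);
      apply (RInt_correct (V := R_CompleteNormedModule)); now apply ex_RInt_cont.
  - apply (is_RInt_scal (V := R_NormedModule) N).
    apply (RInt_correct (V := R_CompleteNormedModule)). now apply ex_RInt_cont. }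
(* Strictness: the integral of [N] is at least $E(t_0)^2 > 0$. *)
pose proof (sqr_le_RInt_sqr a b E dE t0 HE CdE Ea It0) as HN. fold N in HN.
pose proof (pow2_gt_0 _ Et0). fold L0 L1. nra.
Qed.

End Minimality.

(** * Passage from functions on $[a,b]$ to their extensions *)

Theorem theorem8p3 :
  forall (a b m : R) (V xi : R -> R),
    a < b -> 0 < m -> C2_R V -> C2_on a b xi ->
    euler_lagrange a b m V xi ->
    (Rbar_lt (Finite b) (first_conjugate_time a b m V xi) <->
       ~ (exists c : R, conjugate_time a b m V xi c)) /\
    (Rbar_lt (Finite b) (first_conjugate_time a b m V xi) ->
       exists eps : R, 0 < eps /\
         forall eta : R -> R,
           C1_on a b eta -> eta a = 0 -> eta b = 0 ->
           Rbar_lt (Finite 0) (C1_norm a b eta) ->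
           Rbar_lt (C1_norm a b eta) (Finite eps) ->
           Lagr a b m V (fun t => xi t + eta t) > Lagr a b m V xi).
Proof.
intros a b m V xi Hab Hm [HV1 [HV2 CV2]] Hxi HEL.
split; [apply lt_first_conjugate_time|].
intros Hlt. apply lt_first_conjugate_time in Hlt.
destruct (C2_on_extend a b xi Hab Hxi) as (X & h & dh & HX & Hh & Cdh & EX).
pose (V1 := Derive V). pose (V2 := Derive_n V 2).
assert (DV1 : forall x, is_derive V x (V1 x)) by (intros x; apply Derive_correct, (HV1 x)).
assert (DV2 : forall x, is_derive V1 x (V2 x)) by (intros x; apply Derive_correct, (HV2 x)).
pose (P := fun t => m * cosh (h t)). pose (Q := fun t => V2 (X t)).
pose (dP := fun t => m * (dh t * sinh (h t))).
assert (HP : forall t, is_derive P t (dP t)).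
{ intros t. apply is_derive_scal.
  apply (is_derive_comp cosh h); [apply is_derive_cosh|apply Hh]. }
assert (PP : forall t, 0 < P t).
{ intros t. unfold P. pose proof (cosh_ge_1 (h t)). nra. }
assert (CP : forall t, continuous P t) by (intros t; now apply is_derive_continuous with (dP t)).
assert (Ch : forall t, continuous h t) by (intros t; now apply is_derive_continuous with (dh t)).
assert (CX : forall t, continuous X t) by (intros t; now apply is_derive_continuous with (h t)).
assert (CQ : forall t, continuous Q t).
{ intros t. apply (continuous_comp X V2); [apply CX|apply CV2]. }
assert (CdP : forall t, continuous dP t).
{ intros t. apply (continuous_mult (fun _ => m) (fun t => dh t * sinh (h t)));
    [apply continuous_const|].
  apply (continuous_mult dh (fun t => sinh (h t))); [apply Cdh|].
  apply (continuous_comp h sinh); [apply Ch|].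
  exact (is_derive_continuous _ _ _ (is_derive_sinh (h t))). }
destruct (positive_supersolution a b P Q Hab CP CQ PP) as (s & u & p & du & dp & Hs & Hu & Hp & Hup).
(* A zero of [x] at [c] would make [c] conjugate to [a], with [x] itself as the Jacobi field. *)
{ intros x y dx dy Hx Hy Cx Cy E xa ya c Hc Zc. apply Hlt. exists c. split; [exact Hc|].
  assert (Cy0 : forall t, continuous y t) by (intros t; now apply is_derive_continuous with (dy t)).
  destruct (C1_on_of_C1 a b x x dx Hab (fun _ _ => eq_refl) Hx Cx) as [C1x Dx].
  exists x. split; [split; [exact C1x|]|split; [|split; [|now split]]].
  (* [x] is $C^2$ because on $[a,b]$ its derivative is a quotient of $C^1$ functions. *)
  - apply (C1_on_of_C1 a b _ (fun t => y t / P t)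
      (fun t => (dy t * P t - y t * dP t) / P t ^ 2) Hab).
    + intros t Ht. rewrite Dx by exact Ht. now apply E.
    + intros t. apply is_derive_div; [apply Hy|apply HP|apply Rgt_not_eq, PP].
    + intros t.
      apply (continuous_mult (fun t => dy t * P t - y t * dP t) (fun t => / P t ^ 2)).
      * apply (continuous_minus (fun t => dy t * P t) (fun t => y t * dP t)).
        -- now apply (continuous_mult dy P).
        -- now apply (continuous_mult y dP).
      * apply (continuous_comp (fun t => P t ^ 2) Rinv).
        -- apply (continuous_mult P (fun t => P t * 1)); [apply CP|].
           apply (continuous_mult P (fun _ => 1)); [apply CP|apply continuous_const].
        -- apply continuous_Rinv. apply pow_nonzero, Rgt_not_eq, PP.
  - intros t Ht.
    (* The momentum $Px'$ agrees with [y] on $[a,b]$, so the Jacobi equation reads $y' = -Qx$. *)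
    destruct (C1_on_of_C1 a b
      (fun r => m * cosh (Derive_on a b xi r) * Derive_on a b x r) y dy Hab) as [_ DD].
    + intros r Hr. destruct (EX r Hr) as [_ [-> _]]. rewrite Dx by exact Hr.
      destruct (E r Hr) as [-> _]. fold (P r). field. apply Rgt_not_eq, PP.
    + exact Hy.
    + exact Cy.
    + rewrite DD by exact Ht. destruct (EX t Ht) as [-> _].
      destruct (E t Ht) as [_ ->]. unfold Q, V2. ring.
  (* A trivial [x] would have slope 0 at [a], whereas the slope there is [/ P a]. *)
  - apply NNPP. intros Hn.
    assert (Z : forall t, Icc a b t -> x t = 0).
    { intros t Ht. apply NNPP. intros Hz. apply Hn. now exists t. }
    assert (Ia : Icc a b a) by (unfold Icc; lra).
    destruct (C1_on_of_C1 a b x (fun _ => 0) (fun _ => 0) Hab Z) as [_ DZ].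
    { intros r. apply (is_derive_const 0). }
    { intros r. apply continuous_const. }
    specialize (DZ a Ia). rewrite Dx in DZ by exact Ia.
    destruct (E a Ia) as [Ea _]. rewrite Ea, ya in DZ.
    pose proof (Rinv_0_lt_compat _ (PP a)). lra. }
destruct (action_increment_pos a b m V V1 V2 X h dh) with (s := s) (u := u) (p := p) (du := du) (dp := dp)
  as [eps [Heps Hmin]]; auto.
{ intros t Ht. specialize (HEL t Ht). destruct (EX t Ht) as [E0 [E1 E2]].
  rewrite E0, E1, E2 in HEL. exact HEL. }
exists eps. split; [exact Heps|]. intros eta Heta Ea Eb Npos Nlt.
destruct (C1_on_extend a b eta Hab Heta) as (E & dE & HE & CdE & EE).
assert (Ia : Icc a b a) by (unfold Icc; lra).
assert (Ib : Icc a b b) by (unfold Icc; lra).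
destruct (C1_on_of_C1 a b (fun t => xi t + eta t) (fun t => X t + E t) (fun t => h t + dE t) Hab)
  as [_ DS].
{ intros t Ht. now rewrite (proj1 (EX t Ht)), (proj1 (EE t Ht)). }
{ intros t. now apply (is_derive_plus X E). }
{ intros t. now apply (continuous_plus h dE). }
apply Rlt_gt. unfold Lagr.
(* Both actions are rewritten with the extensions, which agree with the original data under the
   integrals. *)
rewrite (RInt_ext (V := R_CompleteNormedModule)
  (fun t => m * (cosh (Derive_on a b xi t) - 1) - V (xi t))
  (fun t => m * (cosh (h t) - 1) - V (X t))).
2:{ rewrite Rmin_left, Rmax_right by lra. intros t Ht.
  assert (It : Icc a b t) by (unfold Icc; lra).
  destruct (EX t It) as [-> [-> _]]. reflexivity. }
rewrite (RInt_ext (V := R_CompleteNormedModule)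
  (fun t => m * (cosh (Derive_on a b (fun t => xi t + eta t) t) - 1) - V (xi t + eta t))
  (fun t => m * (cosh (h t + dE t) - 1) - V (X t + E t))).
2:{ rewrite Rmin_left, Rmax_right by lra. intros t Ht.
  assert (It : Icc a b t) by (unfold Icc; lra).
  rewrite DS by exact It. destruct (EX t It) as [-> _]. destruct (EE t It) as [-> _].
  reflexivity. }
apply Hmin; auto.
- now rewrite <- (proj1 (EE a Ia)).
- now rewrite <- (proj1 (EE b Ib)).
- destruct (C1_norm_pos a b eta Hab Npos) as [t [Ht Nt]]. exists t. split; [exact Ht|].
  now rewrite <- (proj1 (EE t Ht)).
- intros t Ht. destruct (EE t Ht) as [<- <-]. now apply C1_norm_lt.
Qed.
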